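(* Let $(M,d)$ be the countable metric space defined in the context. There is an equivalent norm $|\cdot|$ on $\ell_1$ such that $M$ embeds isometrically into $(\ell_1,|\cdot|)$.
   Context: $\mathbb N=\{1,2,3,\dots\}$. The metric space $(M,d)$: let $F=\{A\subset\mathbb N: 1\le |A|<\infty\}$ be the set of all finite nonempty subsets of $\mathbb N$, and let $M=\{\emptyset\}\cup\mathbb N\cup F$ (the three pieces are regarded as pairwise disjoint). Make $M$ into a graph by putting an edge between $\emptyset$ and every $n\in\mathbb N$, and an edge between $n\in\mathbb N$ and $A\in F$ exactly when $n\in A$; there are no other edges. The metric $d$ is the shortest path metric of this graph. Explicitly, for $n\ne m$ in $\mathbb N$ and $A\neq B$ in $F$: $d(\emptyset,n)=1$; $d(n,m)=2$; $d(n,A)=1$ if $n\in A$ and $d(n,A)=3$ if $n\notin A$; $d(\emptyset,A)=2$; $d(A,B)=2$ if $A\cap B\ne\emptyset$ and $d(A,B)=4$ if $A\cap B=\emptyset$. ''Equivalent norm'' means equivalent to the usual norm of $\ell_1$; ''embeds isometrically'' means there is a (not necessarily linear) distance-preserving map $M\to(\ell_1,|\cdot|)$. *)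

(* Defs.v *)
From HB Require Import structures.
From mathcomp Require Import all_boot all_order all_algebra finmap.
From mathcomp Require Import all_classical all_reals all_analysis.
Set Implicit Arguments.
Unset Strict Implicit.
Unset Printing Implicit Defensive.
Import Order.TTheory GRing.Theory Num.Theory.
Local Open Scope ring_scope.

Definition posnat : Type := {n : nat | (0 < n)%N}.

Definition nefset : Type := {A : {fset posnat} | (1 <= #|` A|)%N}.

Inductive M : Type :=
| Mempty
| Mnat of posnat
| Mset of nefset.

Definition adj (x y : M) : bool :=
  match x, y with
  | Mempty, Mnat _ | Mnat _, Mempty => true
  | Mnat n, Mset A | Mset A, Mnat n => n \in val A
  | _, _ => false
  end.

Definition walk (x y : M) (k : nat) : Prop :=
  exists p : seq M, [/\ path adj x p, last x p = y & size p = k].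

Lemma walk0 x : walk x x 0.
Proof. by exists [::]. Qed.

Lemma walkS x y z k : adj x y -> walk y z k -> walk x z k.+1.
Proof. by move=> xy [p [yp pz <-]]; exists (y :: p); rewrite /= xy. Qed.

Lemma walk_cat x y z k l : walk x y k -> walk y z l -> walk x z (k + l).
Proof.
move=> [p [xp py <-]] [q [yq qz <-]]; exists (p ++ q).
by rewrite cat_path last_cat py xp yq size_cat.
Qed.

Lemma adjC x y : adj x y = adj y x.
Proof. by case: x y => [|n|A] [|m|B]. Qed.

Lemma walkC x y k : walk x y k -> walk y x k.
Proof.
elim: k x y => [|k IH] x y [[|z p] [//= + <-]] //= => [_ _|].
  exact: walk0.
move=> /andP[xz zp] [pk].
have /IH yz : walk z (last z p) k by exists p.
rewrite -addn1; apply: walk_cat yz _.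
by apply: walkS (walk0 _); rewrite adjC.
Qed.

Lemma nefsetP (A : nefset) : exists n, n \in val A.
Proof.
by case: A => A /= A0; apply/fset0Pn; rewrite -cardfs_gt0.
Qed.

Lemma walk_Mempty x : exists k, walk Mempty x k.
Proof.
case: x => [|n|A]; first by exists 0; exact: walk0.
  by exists 1; apply: walkS (walk0 _).
have [n nA] := nefsetP A.
by exists 2; apply: (@walkS _ (Mnat n)) => //; apply: walkS (walk0 _).
Qed.

Lemma M_connected x y : exists k, `[< walk x y k >].
Proof.
have [k /walkC xk] := walk_Mempty x; have [l yl] := walk_Mempty y.
by exists (k + l)%N; apply/asboolP; exact: walk_cat yl.
Qed.

Definition d (x y : M) : nat := ex_minn (M_connected x y).

Lemma dP x y k : walk x y k -> (forall l, walk x y l -> (k <= l)%N) ->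
  d x y = k.
Proof.
rewrite /d => xyk mink; case: ex_minnP => m /asboolP xym minm.
apply/eqP; rewrite eqn_leq mink// andbT; apply: minm; exact/asboolP.
Qed.

Lemma dxx x : d x x = 0%N.
Proof. by apply: dP => //; exact: walk0. Qed.

Lemma dC x y : d x y = d y x.
Proof.
rewrite /d; case: ex_minnP => m /asboolP /walkC xym minm.
case: ex_minnP => n /asboolP xyn minn; apply/eqP; rewrite eqn_leq.
by rewrite minm ?minn//; apply/asboolP => //; exact: walkC.
Qed.

Lemma d_Mempty_Mnat n : d Mempty (Mnat n) = 1%N.
Proof.
apply: dP; first exact: walkS (walk0 _).
by move=> [|l]// [[|? ?] []].
Qed.

Lemma d_Mnat n m : n != m -> d (Mnat n) (Mnat m) = 2%N.
Proof.
move=> nm; apply: dP.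
  by apply: (@walkS _ Mempty) => //; apply: walkS (walk0 _).
move=> [|[|l]]// [[|a [|? ?]]] []//.
  by move=> _ [] /eqP; rewrite (negPf nm).
by move=> /= /andP[+ _] am _; rewrite am.
Qed.

Lemma d_Mnat_Mset n A :
  d (Mnat n) (Mset A) = (if n \in val A then 1 else 3)%N.
Proof.
case: ifPn => nA; apply: dP.
- exact: walkS (walk0 _).
- by move=> [|l]// [[|? ?] []].
- have [m mA] := nefsetP A.
  apply: (@walkS _ Mempty) => //; apply: (@walkS _ (Mnat m)) => //.
  exact: walkS (walk0 _).
move=> [|[|[|l]]]// [[|a [|b [|? ?]]]] []//.
  by move=> /= /andP[+ _] aA _; rewrite aA/= (negPf nA).
by move=> /= /and3P[+ + _] bA _; rewrite bA; case: a.
Qed.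

Lemma d_Mempty_Mset A : d Mempty (Mset A) = 2%N.
Proof.
have [m mA] := nefsetP A; apply: dP.
  by apply: (@walkS _ (Mnat m)) => //; apply: walkS (walk0 _).
move=> [|[|l]]// [[|a [|? ?]]] []//.
by move=> /= /andP[+ _] aA _; rewrite aA.
Qed.

Lemma d_Mset A B : A != B ->
  d (Mset A) (Mset B) = (if (val A `&` val B)%fset != fset0 then 2 else 4)%N.
Proof.
move=> AB; case: ifPn => AIB; apply: dP.
- have /fset0Pn[n] := AIB; rewrite inE => /andP[nA nB].
  by apply: (@walkS _ (Mnat n)) => //; apply: walkS (walk0 _).
- move=> [|[|l]]// [[|a [|? ?]]] []//.
    by move=> _ [] /eqP; rewrite (negPf AB).
  by move=> /= /andP[+ _] aA _; rewrite aA.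
- have [n nA] := nefsetP A; have [m mB] := nefsetP B.
  apply: (@walkS _ (Mnat n)) => //; apply: (@walkS _ Mempty) => //.
  by apply: (@walkS _ (Mnat m)) => //; apply: walkS (walk0 _).
move=> [|[|[|[|l]]]]// [[|a [|b [|c [|? ?]]]]] []//.
- by move=> _ [] /eqP; rewrite (negPf AB).
- by move=> /= /andP[+ _] aB _; rewrite aB.
- move=> /= /and3P[+ + _] bB _; rewrite bB; case: a => // n nA nB.
  by case/negP: AIB; apply/fset0Pn; exists n; rewrite inE nA.
- by move=> /= /and4P[+ + + _] cB _; rewrite cB; case: a => // n _; case: b.
Qed.

(* [LfunType] consists of functions, not of classes modulo a.e. equality; for
   the counting measure on [nat] the two coincide. *)
Definition ell1 (R : realType) : lmodType R :=
  LfunType (@counting nat R) (lexx (1%:E : \bar R)).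

Definition ell1_norm (R : realType) (f : ell1 R) : R :=
  fine ('N[@counting nat R]_1%:E [EFin \o (f : nat -> R)])%E.

Lemma ell1_normE (R : realType) (f : ell1 R) :
  (ell1_norm f)%:E = (\sum_(k <oo) `|(f : nat -> R) k|%:E)%E.
Proof.
rewrite /ell1_norm finite_norm_fine Lnorm_counting// invr1.
rewrite poweRe1; last by apply: nneseries_ge0 => k _ _; exact: poweR_ge0.
by apply: eq_eseriesr => k _; rewrite poweRe1.
Qed.

Lemma ell1P (R : realType) (u : nat -> R) :
  (\sum_(k <oo) `|u k|%:E < +oo)%E <-> exists f : ell1 R, (f : nat -> R) = u.
Proof.
split=> [uoo|[f <-]]; last by rewrite -ell1_normE ltry.
have uL : u \in Lfun (@counting nat R) 1%:E.
  apply/andP; split; first by rewrite inE.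
  rewrite /finLfun; apply/mem_set; rewrite /= /finite_norm Lnorm_counting//.
  rewrite invr1 poweRe1; last first.
    by apply: nneseries_ge0 => k _ _; exact: poweR_ge0.
  by under eq_eseriesr do rewrite poweRe1//.
by exists (Lfun_Sub (lexx _) uL).
Qed.

Definition is_norm (R : realType) (V : lmodType R) (N : V -> R) : Prop :=
  [/\ forall x y, N (x + y) <= N x + N y,
      forall (a : R) x, N (a *: x) = `|a| * N x &
      forall x, N x = 0 -> x = 0].

Definition equivalent_norms (R : realType) (V : lmodType R) (N1 N2 : V -> R) :
    Prop :=
  exists a b : R, [/\ 0 < a, 0 < b & forall x, a * N1 x <= N2 x <= b * N1 x].

(* Main.v *)
(* The space [M] is countable and its distances between distinct points lie in
   [1, 4]. Hence it embeds as the unit vectors [e_(c x)], [c] an injection of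
   [M] into [nat], for the norm [N a = sup_h \sum_k a_k h_k], where [h] ranges
   over the sequences bounded by 4 for which [h \o c] is 1-Lipschitz. Every
   sequence with values in [-1/2, 1/2] is such an [h], as distinct points are
   at distance at least 1, so [N] is equivalent to the usual norm; the distance
   to [x] is such an [h] as well, so [N (e_(c x) - e_(c y)) = d x y]. *)
Require Import Defs.
From mathcomp Require Import all_boot all_order all_algebra finmap.
From mathcomp Require Import all_classical all_reals all_analysis.
Import Order.TTheory GRing.Theory Num.Theory.
Import numFieldNormedType.Exports.
Local Open Scope ring_scope.

(** * Countability of [M] and bounds on its metric *)

Definition M_code (x : M) : option (posnat + nefset) :=
  match x with
  | Mempty => None
  | Mnat n => Some (inl n)
  | Mset A => Some (inr A)
  end.

Definition M_decode (u : option (posnat + nefset)) : M :=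
  match u with
  | None => Mempty
  | Some (inl n) => Mnat n
  | Some (inr A) => Mset A
  end.

Lemma M_codeK : cancel M_code M_decode.
Proof. by case. Qed.

(** The codomain of [M_code] is an option of a sum of countable types, so its [pickle] and
    [unpickle] transport to [M]. *)
Lemma M_countable : exists (c : M -> nat) (g : nat -> option M), pcancel c g.
Proof.
exists (choice.pickle \o M_code), (omap M_decode \o choice.unpickle) => x.
by rewrite /comp choice.pickleK /= M_codeK.
Qed.

Lemma d_walk (x y : M) : walk x y (d x y).
Proof. by rewrite /d; case: ex_minnP => k /asboolP. Qed.

Lemma d_min (x y : M) (k : nat) : walk x y k -> (d x y <= k)%N.
Proof.
by rewrite /d; case: ex_minnP => m _ minm xyk; apply: minm; exact/asboolP.
Qed.

Lemma d_triangle (x y z : M) : (d x z <= d x y + d y z)%N.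
Proof. by apply: d_min; apply: walk_cat; exact: d_walk. Qed.

Lemma d_gt0 (x y : M) : x <> y -> (0 < d x y)%N.
Proof.
move=> xy; case: ltnP => //; rewrite leqn0 => /eqP dxy0.
by have := d_walk x y; rewrite dxy0 => -[[|? ?] []].
Qed.

(** Every point lies within 2 of [Mempty], so any two points are joined through it. *)
Lemma d_le4 (x y : M) : (d x y <= 4)%N.
Proof.
have d2 z : (d Mempty z <= 2)%N.
  by case: z => [|n|A]; rewrite ?dxx ?d_Mempty_Mnat ?d_Mempty_Mset.
apply: leq_trans (d_triangle x Mempty y) _; rewrite dC.
exact: (leq_add (d2 x) (d2 y)).
Qed.

(** * The usual norm and the duality with bounded sequences *)

Lemma ell1_norm_cvg {R : realType} (a : ell1 R) :
  (series (fun k => `|(a : nat -> R) k|) n @[n --> \oo] --> ell1_norm a)%classic.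
Proof.
have acvg : cvgn (series (fun k => `|(a : nat -> R) k|)).
  by apply: nnseries_is_cvg => //; apply/ell1P; exists a.
suff -> : ell1_norm a = limn (series (fun k => `|(a : nat -> R) k|)) by [].
apply: EFin_inj; rewrite ell1_normE -EFin_lim//; congr (limn _).
by apply/funext => n /=; rewrite sumEFin.
Qed.

Lemma ell1_norm_ge {R : realType} (a : ell1 R) (k : nat) :
  `|(a : nat -> R) k| <= ell1_norm a.
Proof.
have acvg := ell1_norm_cvg a; rewrite -(cvg_lim _ acvg)//.
(* The partial sum of length [k.+1] is the first one that contains the term of index [k]. *)
apply: le_trans (nondecreasing_cvgn_le _ (cvgP _ acvg) k.+1).
  by rewrite seriesSr lerDr sumr_ge0.
by apply/nondecreasing_seqP => n; rewrite seriesSr lerDl.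
Qed.

Lemma ell1_norm_eq0 {R : realType} (a : ell1 R) : ell1_norm a = 0 -> a = 0.
Proof.
move=> a0; apply: val_inj; apply/funext => k; apply/eqP.
by rewrite -normr_le0 -a0 ell1_norm_ge.
Qed.

(** The duality bracket of $\ell_1$ with $\ell_\infty$. Since [limn] is a mere default value on a
    divergent series, most rules below ask for a bound on [h]. *)
Definition pairing {R : realType} (a h : nat -> R) : R :=
  limn (series (a \* h)).

Section Pairing.
Context {R : realType}.
Implicit Types (a b : ell1 R) (h : nat -> R) (C : R).

Lemma pairing_normed_cvg a {h C} : (forall k, `|h k| <= C) ->
  cvgn [normed series ((a : nat -> R) \* h)].
Proof.
move=> hC.
apply: (@series_le_cvg _ _ (C *: (fun k => `|(a : nat -> R) k|))) => //=.
(* The bound at index 0 forces [C] to be nonnegative. *)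
- move=> n; rewrite mulr_ge0//; exact: le_trans (hC 0%N).
- by move=> n; rewrite normrM mulrC ler_wpM2r.
- by apply: is_cvg_seriesZ; apply: cvgP (ell1_norm_cvg a).
Qed.

Lemma pairing_cvg a {h C} : (forall k, `|h k| <= C) ->
  cvgn (series ((a : nat -> R) \* h)).
Proof. by move=> /(pairing_normed_cvg a)/normed_cvg. Qed.

Lemma pairing_le a {h C} : (forall k, `|h k| <= C) ->
  `|pairing a h| <= C * ell1_norm a.
Proof.
move=> hC; have ahcvg := pairing_normed_cvg a hC.
apply: le_trans (lim_series_norm ahcvg) _.
have acvg := ell1_norm_cvg a.
have Ccvg := is_cvg_seriesZ (k := C) (cvgP _ acvg).
rewrite -(cvg_lim _ acvg)// -[C * _]lim_seriesZ; last exact: cvgP acvg.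
apply: lim_series_le => // n.
by rewrite /= normrM mulrC ler_wpM2r.
Qed.

Lemma pairingD a b {h C} : (forall k, `|h k| <= C) ->
  pairing (a + b : ell1 R) h = pairing a h + pairing b h.
Proof.
move=> hC; rewrite /pairing -lim_seriesD; try exact: pairing_cvg hC.
by congr (limn (series _)); apply/funext => k; rewrite /= mulrDl.
Qed.

Lemma pairingZ (x : R) a {h C} : (forall k, `|h k| <= C) ->
  pairing (x *: a : ell1 R) h = x * pairing a h.
Proof.
move=> hC; rewrite /pairing -[x * _]lim_seriesZ; last exact: pairing_cvg hC.
by congr (limn (series _)); apply/funext => k; rewrite /= -mulrA.
Qed.

Lemma pairingN a {h C} : (forall k, `|h k| <= C) ->
  pairing a (\- h) = - pairing a h.
Proof.
move=> hC; rewrite /pairing -lim_seriesN; last exact: pairing_cvg hC.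
by congr (limn (series _)); apply/funext => k; rewrite /= mulrN.
Qed.

(** Signs turn each term into [r] times an absolute value; this choice of sequence yields the lower
    bound in the equivalence of norms. *)
Lemma pairing_sg a (r : R) :
  pairing a (fun k => r * Num.sg ((a : nat -> R) k)) = r * ell1_norm a.
Proof.
have acvg := ell1_norm_cvg a.
rewrite /pairing -(cvg_lim _ acvg)// -[r * _]lim_seriesZ; last exact: cvgP acvg.
congr (limn (series _)); apply/funext => k /=.
by rewrite mulrCA [_ * Num.sg _]mulrC -normrEsg.
Qed.

Lemma series_unit_cvg (i : nat) h :
  (series ((fun k => (k == i)%:R) \* h) n @[n --> \oo] --> h i)%classic.
Proof.
apply: cvg_near_cst; near=> n; rewrite seriesEnat /=.
under eq_bigr => k _ do rewrite mulr_natl mulrb.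
rewrite -big_mkcond big_nat1_eq leq0n ifT//.
by near: n; exact: nbhs_infty_gt.
Unshelve. all: by end_near. Qed.

(** No bound on [h] is required, since the partial sums are eventually constant. *)
Lemma ell1_unit (i : nat) : exists e : ell1 R,
  forall h, pairing e h = h i.
Proof.
have /ell1P[e eE] : (\sum_(k <oo) `|(k == i)%:R : R|%:E < +oo)%E.
  (* Summability is the case of the constant sequence 1. *)
  have := series_unit_cvg i (fun=> 1); set u := _ \* _ => ucvg.
  rewrite (_ : (fun n => _) = EFin \o series u); last first.
    apply/funext => n; rewrite /= -sumEFin; apply: eq_bigr => k _.
    by rewrite /u /= mulr1 normr_nat.
  by rewrite EFin_lim ?ltry//; exact: cvgP ucvg.
exists e => h; rewrite /pairing eE; apply: cvg_lim => //.
exact: series_unit_cvg.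
Qed.

End Pairing.

(** * Norms defined as suprema over a set of bounded sequences *)

Definition dual_norm {R : realType} (H : set (nat -> R)) (a : ell1 R) : R :=
  sup [set pairing a h | h in H]%classic.

Section DualNorm.
Context {R : realType} {H : set (nat -> R)} {r C : R}.
Hypothesis r_gt0 : 0 < r.
Hypothesis H_bounded : forall h, H h -> forall k, `|h k| <= C.
Hypothesis H_opp : forall h, H h -> H (\- h).
Hypothesis H_ball : forall h, (forall k, `|h k| <= r) -> H h.
Implicit Types a b : ell1 R.

Let H0 : H (fun=> 0).
Proof. by apply: H_ball => k; rewrite normr0 ltW. Qed.

(** The absolute value comes from the symmetry of [H]; the bound [C] makes the supremum a genuine
    one. *)
Lemma dual_norm_ge a h : H h -> `|pairing a h| <= dual_norm H a.
Proof.
have ge g : H g -> pairing a g <= dual_norm H a.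
  move=> Hg; apply: ub_le_sup; last by exists g.
  exists (C * ell1_norm a) => _ [f Hf <-].
  exact: le_trans (ler_norm _) (pairing_le a (H_bounded _ Hf)).
move=> Hh; rewrite ler_norml ge// lerNl -(pairingN _ (H_bounded _ Hh)).
by rewrite ge//; exact: H_opp.
Qed.

Lemma dual_norm_le a x : (forall h, H h -> pairing a h <= x) ->
  dual_norm H a <= x.
Proof.
move=> le; apply: ge_sup; first by exists (pairing a (fun=> 0)), (fun=> 0).
by move=> _ [h Hh <-]; exact: le.
Qed.

Lemma dual_norm_equivalent : equivalent_norms (@ell1_norm R) (dual_norm H).
Proof.
(* The constant sequence [r] belongs to [H], whence [r <= C]. *)
have C_gt0 : 0 < C.
  have /H_bounded/(_ 0%N) : H (fun=> r).
    by apply: H_ball => k; rewrite gtr0_norm.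
  by apply: lt_le_trans; rewrite gtr0_norm.
exists r, C; split=> // a; apply/andP; split; last first.
  apply: dual_norm_le => h Hh.
  exact: le_trans (ler_norm _) (pairing_le a (H_bounded _ Hh)).
rewrite -pairing_sg; apply: le_trans (ler_norm _) (dual_norm_ge _ _ _).
apply: H_ball => k; rewrite normrM gtr0_norm// ler_piMr ?(ltW r_gt0)//.
by rewrite normr_sg; case: (_ != 0); rewrite ?lexx ?ler01.
Qed.

Lemma dual_norm_is_norm : is_norm (dual_norm H).
Proof.
have normZ_le x a : dual_norm H (x *: a) <= `|x| * dual_norm H a.
  apply: dual_norm_le => h Hh; rewrite (pairingZ _ _ (H_bounded _ Hh)).
  apply: le_trans (ler_norm _) _; rewrite normrM ler_wpM2l//.
  exact: dual_norm_ge.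
split=> [a b|x a|a Na0].
- apply: dual_norm_le => h Hh; rewrite (pairingD _ _ (H_bounded _ Hh)).
  by apply: lerD; apply: le_trans (ler_norm _) (dual_norm_ge _ _ Hh).
(* The reverse inequality is nonnegativity when [x = 0], and otherwise [normZ_le] for the scalar
   [x^-1] and the vector [x *: a]. *)
- apply/eqP; rewrite eq_le normZ_le/=; have [->|x0] := eqVneq x 0.
    by rewrite normr0 mul0r; exact: le_trans (dual_norm_ge _ _ H0).
  rewrite mulrC -ler_pdivlMr ?normr_gt0// mulrC -normfV.
  by have := normZ_le x^-1 (x *: a); rewrite scalerA mulVf// scale1r.
(* Definiteness is inherited from the usual norm through the lower bound. *)
- have [s [t [s0 _ /(_ a)]]] := dual_norm_equivalent.
  rewrite Na0 => /andP[sa _]; apply: ell1_norm_eq0; apply/eqP.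
  rewrite eq_le -(pmulr_rle0 _ s0) sa /=.
  exact: le_trans (ell1_norm_ge _ 0).
Qed.

End DualNorm.

Theorem proposition10 (R : realType) :
  exists N : ell1 R -> R,
    [/\ is_norm N,
        equivalent_norms (@ell1_norm R) N &
        exists phi : M -> ell1 R,
          forall x y : M, N (phi x - phi y) = (d x y)%:R].
Proof.
have [c [g gK]] := M_countable.
(* The explicit bound is needed because the Lipschitz condition is blind to added constants and to
   indices outside the range of [c]. *)
pose H : set (nat -> R) := [set h | (forall k, `|h k| <= 4) /\
  forall x y, h (c x) - h (c y) <= (d x y)%:R]%classic.
have H_bounded h : H h -> forall k, `|h k| <= 4 by case.
have H_opp h : H h -> H (\- h).
  move=> [h4 hd]; split=> [k|x y]; first by rewrite normrN.
  by rewrite /= opprK addrC dC.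
have H_ball h : (forall k, `|h k| <= 2^-1) -> H h.
  move=> hr; split=> [k|x y].
    apply: le_trans (hr k) (@le_trans _ _ 1 _ _ _ _); last by rewrite ler1n.
    by rewrite invf_le1 ?ler1n ?ltr0n.
  have [->|/d_gt0 dxy] := pselect (x = y); first by rewrite subrr.
  apply: (@le_trans _ _ 1); last by rewrite ler1n.
  apply: le_trans (ler_norm _) _; apply: le_trans (ler_normB _ _) _.
  by rewrite [leRHS]splitr mul1r lerD.
have r_gt0 : 0 < 2^-1 :> R by rewrite invr_gt0.
exists (dual_norm H); split.
- exact: dual_norm_is_norm r_gt0 H_bounded H_opp H_ball.
- exact: dual_norm_equivalent r_gt0 H_bounded H_opp H_ball.
have /choice[e eE] := @ell1_unit R.
exists (e \o c) => x y.
have eB h : H h -> pairing (e (c x) - e (c y)) h = h (c x) - h (c y).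
  move=> Hh; rewrite (pairingD _ _ (H_bounded _ Hh)) -scaleN1r.
  by rewrite (pairingZ _ _ (H_bounded _ Hh)) mulN1r !eE.
apply/eqP; rewrite eq_le; apply/andP; split.
  apply: (dual_norm_le r_gt0 H_ball) => h Hh.
  by rewrite eB//; case: Hh.
(* The distance to [y], read through [g]. Outside the range of [c] only the bound by 4 is at stake,
   so the default 0 is harmless. *)
pose h k : R := oapp (fun z => (d z y)%:R) 0 (g k).
have hc z : h (c z) = (d z y)%:R by rewrite /h gK.
have Hh : H h.
  split=> [k|z t]; last by rewrite !hc lerBlDr -natrD ler_nat d_triangle.
  by rewrite /h; case: (g k) => [z|]/=; rewrite ?normr0// normr_nat ler_nat d_le4.
(* At this [h] the pairing is [d x y - d y y], so the Lipschitz bound is attained. *)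
apply: le_trans (dual_norm_ge H_bounded H_opp _ _ Hh).
by rewrite eB// !hc dxx subr0 normr_nat.
Qed.
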